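(* Let $p\in(0,\infty)$ and $k\in\{0,1,\dots\}$. Then $$\ell_k(p)<\ell_{k+1}(p)<\ell_\infty(p)=\frac{d\ln r(p)}{dp}=u_\infty(p)<u_{k+1}(p)<u_k(p).$$ Equivalently, $$\tilde\ell_k(x)<\tilde\ell_{k+1}(x)<\tilde\ell_\infty(x)=\psi(x+1)-\psi(x+\tfrac12)=\tilde u_\infty(x)<\tilde u_{k+1}(x)<\tilde u_k(x)$$ for all $x\in(-\tfrac12,\infty)$ and $k\in\{0,1,\dots\}$. Moreover, one has the following bounds on the errors: $$0<u_k(p)-\frac{d\ln r(p)}{dp}<\frac{d\ln r(p)}{dp}-\ell_k(p)<\frac{2^{-k-1}(k+1)!}{p^{(k+2)}}<\frac{2^{-k-1}}p,$$ which converges to $0$ as $k\to\infty$ (no slower than geometrically) uniformly in $p\in[p_0,\infty)$, for any $p_0\in(0,\infty)$, and also converges, for each $k\in\{0,1,\dots\}$, to $0$ as $p\to\infty$.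
   Context: For $p\in(0,\infty)$, $$r(p):=\sqrt{\frac2p}\,\frac{\Gamma\big(\frac{p+1}2\big)}{\Gamma\big(\frac p2\big)},$$ and $\psi:=\Gamma'/\Gamma$ is the digamma function. For real $y>0$ and integers $m\ge0$, $y^{(m)}:=\prod_{j=0}^{m-1}(y+j)=\frac{\Gamma(y+m)}{\Gamma(y)}$ is the Pochhammer symbol (rising factorial), with $y^{(0)}=1$. For $p\in(0,\infty)$ and $k\in\{0,1,\dots,\infty\}$, $$\ell_k(p):=\sum_{m=1}^k\frac{2^{-1-m}\,m!}{p^{(m+1)}},\qquad u_k(p):=\frac1{2p(p+1)}-\ell_k(p+1),$$ where an empty sum is $0$. For $x\in(-\frac12,\infty)$ and $k\in\{0,1,\dots,\infty\}$, with $p:=2x+1\in(0,\infty)$, $$\tilde\ell_k(x):=\frac1p+2\ell_k(p),\qquad \tilde u_k(x):=\frac1p+2u_k(p).$$ In the last sentence of the claim, ''which'' refers to the error bound $2^{-k-1}/p$ (and hence to the smaller quantities in the chain). Convergence to $0$ ''no slower than geometrically, uniformly in $p\in[p_0,\infty)$'' means being bounded by $Cq^k$ for all $p\ge p_0$ and all $k$, for some constants $C\in(0,\infty)$ and $q\in(0,1)$ possibly depending on $p_0$. *)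

(* Defs.v *)
From Stdlib Require Import Reals Factorial.
From Coquelicot Require Import Coquelicot.
Open Scope R_scope.

(* Euler's integral of the second kind, as an improper Riemann integral over
   (0, oo); [Gamma] is only meant to be used at positive arguments. *)
Definition Gamma (x : R) : R :=
  RInt_gen (fun t : R => Rpower t (x - 1) * exp (- t))
    (at_right 0) (Rbar_locally p_infty).

Definition digamma (x : R) : R := Derive Gamma x / Gamma x.

Definition r (p : R) : R :=
  sqrt (2 / p) * (Gamma ((p + 1) / 2) / Gamma (p / 2)).

Definition dlnr (p : R) : R := Derive (fun q : R => ln (r q)) p.

Fixpoint pochhammer (y : R) (m : nat) : R :=
  match m with
  | O => 1
  | S j => pochhammer y j * (y + INR j)
  end.

(* The index set {0, 1, ..., oo}. *)
Inductive natbar : Type :=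
  | nfin (k : nat)
  | ninf.

Coercion nfin : nat >-> natbar.

Definition ell_term (p : R) (m : nat) : R :=
  / 2 ^ (1 + m) * INR (fact m) / pochhammer p (m + 1).

(* The sums start at m = 1; [sum_n_m a 1 0] is 0.  [Series] is indexed from 0,
   hence the shift. *)
Definition ell (k : natbar) (p : R) : R :=
  match k with
  | nfin n => sum_n_m (ell_term p) 1 n
  | ninf => Series (fun j : nat => ell_term p (S j))
  end.

Definition u (k : natbar) (p : R) : R :=
  1 / (2 * p * (p + 1)) - ell k (p + 1).

Definition ell_tilde (k : natbar) (x : R) : R :=
  1 / (2 * x + 1) + 2 * ell k (2 * x + 1).

Definition u_tilde (k : natbar) (x : R) : R :=
  1 / (2 * x + 1) + 2 * u k (2 * x + 1).

Definition geometric_uniform_cv0 (e : nat -> R -> R) : Prop :=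
  forall p0 : R, 0 < p0 ->
  exists C q : R, 0 < C /\ 0 < q < 1 /\
    forall (k : nat) (p : R), p0 <= p -> Rabs (e k p) <= C * q ^ k.

Definition pointwise_cv0_at_infty (e : nat -> R -> R) : Prop :=
  forall k : nat, is_lim (e k) p_infty 0.

Definition errors_vanish (e : nat -> R -> R) : Prop :=
  geometric_uniform_cv0 e /\ pointwise_cv0_at_infty e.

(* Main.v *)
Require Import Defs.
From Stdlib Require Import Reals Factorial Lra Lia.
From Coquelicot Require Import Coquelicot.
Open Scope R_scope.

(** Write [L] for the infinite series [ell ninf] and [G] for [dlnr], the
    logarithmic derivative of [r].  Both satisfy the functional equation
      [F p + F (p + 1) = 1 / (2 p (p + 1))]
    and both tend to 0 at infinity.  Their difference [h] therefore satisfies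
    [h (p + 1) = - h p] and tends to 0, so [|h p| = |h (p + n)|] is 0
    ([antiperiodic_vanishing], [ell_inf_dlnr]).

    For [L], the equation is a telescoping sum ([ell_inf_add_succ]): with
    [T m = m! / p^(m+1)] (rising factorial), shifting [p] to [p + 1] turns [T m]
    into [T m - T (m + 1)], so the [m]-th terms at [p] and at [p + 1] add up to
    [2^-m T m - 2^-(m+1) T (m+1)].

    For [G], the equation is the digamma recurrence
    [digamma (x + 1) = digamma x + 1 / x] ([dlnr_add_succ]), and the decay
    follows from [ln (x - 1) <= digamma x <= ln x] ([dlnr_bound]).  These facts,
    and the differentiability of [Gamma] itself, come from the Bohr-Mollerup
    properties alone: [f = ln Gamma] is convex and [f (x + 1) = f x + ln x].
    At [x + n] the second differences of such an [f] are at most of the order of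
    [h / (x + n)], because the slopes on either side lie between
    [ln (x + n - 1)] and [ln (x + n)]; going back to [x] only subtracts second
    differences of the smooth function [ln], so [f] has no corner at [x]
    ([convex_log_recurrence_almost_flat]), and a convex function without corners
    is differentiable ([almost_flat_is_derive]).

    Once [dlnr = L] is known, [dlnr p - ell k p] is the tail of a positive series,
    and the functional equation identifies [u k p - dlnr p] with the same tail at
    [p + 1].  The inequalities then follow term by term, since [T m] decreases
    strictly in [p] and in [m] ([ell_tail_shift_lt], [ell_tail_lt]). *)

(** * Euler's integral *)

(** For a nonnegative integrand, bounded integrals over compact intervals force
    the improper integral to converge.  The value is recorded as a least upper
    bound because this reduces later inequalities between improper integrals to
    inequalities over compact intervals. *)
Lemma is_RInt_gen_nonneg_bounded (f : R -> R) (M : R) :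
  (forall t, 0 < t -> 0 <= f t) ->
  (forall t, 0 < t -> continuous f t) ->
  (forall a b, 0 < a <= b -> RInt f a b <= M) ->
  exists l,
    is_RInt_gen f (at_right 0) (Rbar_locally p_infty) l /\
    is_lub (fun v => exists a b, 0 < a <= b /\ v = RInt f a b) l.
Proof.
intros f_ge0 f_cont f_le.
assert (f_int : forall a b, 0 < a -> 0 < b -> ex_RInt f a b).
{ intros a b ha hb. apply (ex_RInt_continuous (V := R_CompleteNormedModule)).
  intros z hz. apply f_cont. apply Rlt_le_trans with (2 := proj1 hz).
  now apply Rmin_glb_lt. }
destruct (completeness (fun v => exists a b, 0 < a <= b /\ v = RInt f a b))
  as [l l_lub].
- exists M. intros v (a & b & hab & ->). now apply f_le.
- exists (RInt f 1 1), 1, 1. split; [lra | reflexivity].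
- exists l. split; [| exact l_lub].
  destruct l_lub as [l_ub l_least].
  intros P [eps Peps].
  assert (large : exists a b, 0 < a <= b /\ l - eps < RInt f a b).
  { destruct (Classical_Prop.classic
      (exists a b, 0 < a <= b /\ l - eps < RInt f a b)) as [h | h]; [exact h |].
    exfalso. assert (l <= l - eps); [| destruct eps; simpl in *; lra].
    apply l_least. intros v (a & b & hab & ->).
    apply Rnot_lt_le. intros hlt. apply h. now exists a, b. }
  destruct large as (a0 & b0 & hab0 & hlarge).
  exists (fun a => 0 < a < a0) (fun b => b0 < b).
  + exists (mkposreal a0 (proj1 hab0)). intros y hy hy0.
    apply Rabs_lt_between in hy. unfold minus, plus, opp in hy; simpl in hy. lra.
  + exists b0. intros y hy; exact hy.
  + intros a b ha hb. exists (RInt f a b). split.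
    * apply (RInt_correct (V := R_CompleteNormedModule)), f_int; simpl; lra.
    * apply Peps.
      assert (hle : RInt f a b <= l).
      { apply l_ub. exists a, b. split; [lra | reflexivity]. }
      assert (hge : RInt f a0 b0 <= RInt f a b).
      { rewrite <- (RInt_Chasles f a a0 b) by (apply f_int; lra).
        rewrite <- (RInt_Chasles f a0 b0 b) by (apply f_int; lra).
        assert (0 <= RInt f a a0) by
          (apply RInt_ge_0; [lra | apply f_int; lra | intros; apply f_ge0; lra]).
        assert (0 <= RInt f b0 b) by
          (apply RInt_ge_0; [lra | apply f_int; lra | intros; apply f_ge0; lra]).
        unfold plus; simpl. lra. }
      apply Rabs_lt_between. unfold minus, plus, opp; simpl. lra.
Qed.

Definition gamma_integrand (x t : R) : R := Rpower t (x - 1) * exp (- t).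

Lemma gamma_integrand_gt0 x t : 0 < gamma_integrand x t.
Proof. apply Rmult_lt_0_compat; apply exp_pos. Qed.

Lemma continuous_gamma_integrand x t :
  0 < t -> continuous (gamma_integrand x) t.
Proof.
intros ht. apply (ex_derive_continuous (V := R_NormedModule)).
unfold gamma_integrand, Rpower. auto_derive. exact ht.
Qed.

Lemma ex_RInt_gamma_integrand x a b :
  0 < a -> 0 < b -> ex_RInt (gamma_integrand x) a b.
Proof.
intros ha hb. apply (ex_RInt_continuous (V := R_CompleteNormedModule)).
intros z hz. apply continuous_gamma_integrand.
apply Rlt_le_trans with (2 := proj1 hz). now apply Rmin_glb_lt.
Qed.

(** This is [ln y <= y - 1] at [y = t / (2 x)], multiplied by [x]. *)
Lemma Rpower_le_exp_half x t :
  0 < x -> 0 < t -> Rpower t x <= Rpower (2 * x) x * exp (t / 2).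
Proof.
intros hx ht. unfold Rpower. rewrite <- exp_plus.
assert (h : ln (t / (2 * x)) <= t / (2 * x) - 1).
{ generalize (exp_ineq1_le (ln (t / (2 * x)))).
  rewrite exp_ln by (apply Rdiv_lt_0_compat; lra). lra. }
rewrite ln_div in h by lra.
apply Rmult_le_compat_l with (r := x) in h; [| lra].
replace (x * (t / (2 * x) - 1)) with (t / 2 - x) in h by (field; lra).
destruct (Rle_lt_or_eq_dec (x * ln t) (x * ln (2 * x) + t / 2)) as [hl | ->];
  [lra | left; now apply exp_increasing | right; reflexivity].
Qed.

(** By [Rpower_le_exp_half], [1 + t^x <= C exp (t / 2)] for some constant [C].
    Hence [t^(x-1) exp (-t)] is at most [C^2 t^(x-1) / (1 + t^x)^2], which has the
    bounded antiderivative [- C^2 / (x (1 + t^x))]: one dominating function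
    controls both ends of the half-line. *)
Lemma RInt_gamma_integrand_bounded x :
  0 < x -> exists M, forall a b, 0 < a <= b -> RInt (gamma_integrand x) a b <= M.
Proof.
intros hx. set (C := 1 + Rpower (2 * x) x).
set (F := fun t => - / (1 + Rpower t x)).
set (dF := fun t => x * Rpower t (x - 1) / (1 + Rpower t x) ^ 2).
assert (hpos : forall t, 0 < Rpower t x) by (intros; apply exp_pos).
assert (hC : 1 < C) by (unfold C; generalize (hpos (2 * x)); lra).
exists (C ^ 2 / x). intros a b hab.
assert (hF : is_RInt dF a b (F b - F a)).
{ apply (is_RInt_derive (V := R_CompleteNormedModule) F dF);
    intros z; rewrite Rmin_left, Rmax_right by lra; intros hz.
  - unfold F, dF.
    replace (Rpower z (x - 1)) with (Rpower z x * / z).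
    + assert (h := hpos z). unfold Rpower in *. auto_derive.
      * split; lra.
      * field. lra.
    + unfold Rminus. rewrite Rpower_plus, Rpower_Ropp, Rpower_1 by lra. ring.
  - apply (ex_derive_continuous (V := R_NormedModule)).
    assert (h := hpos z). unfold dF, Rpower in *. auto_derive.
    repeat split; try lra.
    apply Rmult_integral_contrapositive_currified; lra. }
apply Rle_trans with (C ^ 2 / x * (F b - F a)).
- rewrite <- (is_RInt_unique dF a b _ hF).
  change (RInt (gamma_integrand x) a b <= scal (C ^ 2 / x) (RInt dF a b)).
  rewrite <- (RInt_scal (V := R_CompleteNormedModule)) by (eexists; exact hF).
  apply RInt_le; [lra | apply ex_RInt_gamma_integrand; lra | |].
  + apply (ex_RInt_scal (V := R_NormedModule)). eexists; exact hF.
  + intros t ht. unfold gamma_integrand, dF.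
    change (scal (C ^ 2 / x) (x * Rpower t (x - 1) / (1 + Rpower t x) ^ 2))
      with (C ^ 2 / x * (x * Rpower t (x - 1) / (1 + Rpower t x) ^ 2)).
    assert (h1 : 1 + Rpower t x <= C * exp (t / 2)).
    { unfold C. generalize (Rpower_le_exp_half x t hx ltac:(lra)).
      generalize (exp_ineq1_le (t / 2)). lra. }
    assert (h2 : (1 + Rpower t x) ^ 2 <= C ^ 2 * exp t).
    { replace (C ^ 2 * exp t) with ((C * exp (t / 2)) ^ 2).
      - apply pow_incr. split; [generalize (hpos t); lra | exact h1].
      - rewrite Rpow_mult_distr. f_equal.
        replace (exp t) with (exp (t / 2 + t / 2)) by (f_equal; lra).
        rewrite exp_plus. simpl; ring. }
    assert (hp := hpos t).
    replace (C ^ 2 / x * (x * Rpower t (x - 1) / (1 + Rpower t x) ^ 2))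
      with (Rpower t (x - 1) * (C ^ 2 / (1 + Rpower t x) ^ 2)) by (field; lra).
    apply Rmult_le_compat_l; [left; apply exp_pos |].
    rewrite exp_Ropp.
    apply Rmult_le_reg_r with ((1 + Rpower t x) ^ 2 * exp t).
    * apply Rmult_lt_0_compat; [apply pow_lt; lra | apply exp_pos].
    * assert (he := exp_pos t).
      replace (/ exp t * ((1 + Rpower t x) ^ 2 * exp t))
        with ((1 + Rpower t x) ^ 2) by (field; lra).
      replace (C ^ 2 / (1 + Rpower t x) ^ 2 * ((1 + Rpower t x) ^ 2 * exp t))
        with (C ^ 2 * exp t) by (field; lra).
      exact h2.
- rewrite <- (Rmult_1_r (C ^ 2 / x)) at 2. apply Rmult_le_compat_l.
  + left. apply Rdiv_lt_0_compat; [apply pow_lt; lra | lra].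
  + unfold F. assert (ha := hpos a). assert (hb := hpos b).
    assert (0 < / (1 + Rpower b x)) by (apply Rinv_0_lt_compat; lra).
    assert (/ (1 + Rpower a x) <= 1).
    { apply Rle_trans with (/ 1); [| right; apply Rinv_1]. apply Rinv_le_contravar; lra. }
    lra.
Qed.

Lemma Gamma_spec x :
  0 < x ->
  is_RInt_gen (gamma_integrand x) (at_right 0) (Rbar_locally p_infty) (Gamma x) /\
  is_lub (fun v => exists a b, 0 < a <= b /\ v = RInt (gamma_integrand x) a b)
    (Gamma x).
Proof.
intros hx. destruct (RInt_gamma_integrand_bounded x hx) as [M hM].
destruct (is_RInt_gen_nonneg_bounded (gamma_integrand x) M) as (l & hl & hlub).
- intros t _. left. apply gamma_integrand_gt0.
- apply continuous_gamma_integrand.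
- exact hM.
- replace (Gamma x) with l; [now split |].
  symmetry. exact (is_RInt_gen_unique (V := R_CompleteNormedModule) _ _ hl).
Qed.

Lemma Gamma_gt0 x : 0 < x -> 0 < Gamma x.
Proof.
intros hx. apply Rlt_le_trans with (RInt (gamma_integrand x) 1 2).
- apply RInt_gt_0; [lra | intros; apply gamma_integrand_gt0 |].
  intros; apply continuous_gamma_integrand; lra.
- apply (proj2 (Gamma_spec x hx)). exists 1, 2. split; [lra | reflexivity].
Qed.

(** The boundary terms of the integration by parts in [Gamma_succ]. *)
Lemma Rpower_exp_cv0 x :
  0 < x ->
  filterlim (fun t => Rpower t x * exp (- t)) (at_right 0) (locally 0) /\
  filterlim (fun t => Rpower t x * exp (- t)) (Rbar_locally p_infty) (locally 0).
Proof.
intros hx.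
assert (hpos : forall t, 0 < Rpower t x) by (intros; apply exp_pos).
assert (hball : forall (eps : posreal) t, Rpower t x * exp (- t) < eps ->
  ball 0 eps (Rpower t x * exp (- t))).
{ intros eps t h. apply Rabs_lt_between. unfold minus, plus, opp; simpl.
  assert (0 < Rpower t x * exp (- t))
    by (apply Rmult_lt_0_compat; apply exp_pos).
  destruct eps; simpl in *; lra. }
split; intros P [eps Peps].
- exists (mkposreal (exp (ln eps / x)) (exp_pos _)). intros t ht ht0.
  apply Peps, hball. apply Rabs_lt_between in ht.
  unfold minus, plus, opp in ht; simpl in ht.
  apply Rle_lt_trans with (Rpower t x * 1).
  + apply Rmult_le_compat_l; [left; apply hpos |].
    rewrite <- exp_0. left. apply exp_increasing. lra.
  + rewrite Rmult_1_r. rewrite <- (exp_ln eps) by apply cond_pos.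
    apply exp_increasing.
    assert (h : ln t < ln eps / x).
    { rewrite <- (ln_exp (ln eps / x)). apply ln_increasing; lra. }
    apply Rmult_lt_compat_l with (r := x) in h; [| lra].
    replace (x * (ln eps / x)) with (ln eps) in h by (field; lra). exact h.
- set (K := Rpower (2 * x) x). assert (hK : 0 < K) by apply exp_pos.
  exists (Rmax 0 (- 2 * ln (eps / K))). intros t ht.
  assert (ht0 := Rle_lt_trans _ _ _ (Rmax_l _ _) ht).
  assert (ht1 := Rle_lt_trans _ _ _ (Rmax_r _ _) ht).
  apply Peps, hball.
  apply Rle_lt_trans with (K * exp (t / 2) * exp (- t)).
  + apply Rmult_le_compat_r; [left; apply exp_pos |].
    now apply Rpower_le_exp_half.
  + rewrite Rmult_assoc, <- exp_plus.
    replace (t / 2 + - t) with (- (t / 2)) by lra.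
    apply Rmult_lt_reg_l with (/ K); [now apply Rinv_0_lt_compat |].
    replace (/ K * (K * exp (- (t / 2)))) with (exp (- (t / 2))) by (field; lra).
    replace (/ K * eps) with (eps / K) by (field; lra).
    rewrite <- (exp_ln (eps / K)); [apply exp_increasing; lra |].
    apply Rdiv_lt_0_compat; [apply cond_pos | lra].
Qed.

(** Integration by parts: [t^x exp (-t)] vanishes at both ends, and its derivative
    is [x t^(x-1) exp (-t) - t^x exp (-t)]. *)
Lemma Gamma_succ x : 0 < x -> Gamma (x + 1) = x * Gamma x.
Proof.
intros hx. set (F := fun t => Rpower t x * exp (- t)).
set (dF := fun t => x * gamma_integrand x t - gamma_integrand (x + 1) t).
assert (hF : forall t, 0 < t -> is_derive F t (dF t)).
{ intros t ht. unfold F, dF, gamma_integrand.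
  replace (x + 1 - 1) with x by ring.
  replace (Rpower t (x - 1)) with (Rpower t x * / t).
  - unfold Rpower. auto_derive; [lra | field; lra].
  - unfold Rminus. rewrite Rpower_plus, Rpower_Ropp, Rpower_1 by lra. ring. }
assert (hdF : forall t, 0 < t -> Derive F t = dF t)
  by (intros; apply is_derive_unique, hF; lra).
assert (near : filter_prod (at_right 0) (Rbar_locally p_infty)
  (fun ab : R * R => 0 < fst ab < 1 /\ 1 < snd ab)).
{ exists (fun a => 0 < a < 1) (fun b => 1 < b).
  - exists (mkposreal 1 Rlt_0_1). intros y hy hy0.
    apply Rabs_lt_between in hy. unfold minus, plus, opp in hy; simpl in hy. lra.
  - exists 1. trivial.
  - intros; simpl; lra. }
assert (h1 : is_RInt_gen (Derive F) (at_right 0) (Rbar_locally p_infty) (0 - 0)).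
{ destruct (Rpower_exp_cv0 x hx) as [lim0 liminf].
  apply is_RInt_gen_Derive; [| | exact lim0 | exact liminf].
  - apply filter_imp with (2 := near). intros [a b] [ha hb] z; simpl in *.
    rewrite Rmin_left by lra. intros hz. exists (dF z). apply hF; lra.
  - apply filter_imp with (2 := near). intros [a b] [ha hb] z; simpl in *.
    rewrite Rmin_left by lra. intros hz.
    apply continuous_ext_loc with dF.
    + exists (mkposreal z ltac:(lra)). intros y hy. symmetry. apply hdF.
      apply Rabs_lt_between in hy. unfold minus, plus, opp in hy; simpl in hy. lra.
    + unfold dF. apply (continuous_minus (V := R_NormedModule)).
      * apply (continuous_scal_r (V := R_NormedModule)).
        apply continuous_gamma_integrand; lra.
      * apply continuous_gamma_integrand; lra. }
assert (h2 : is_RInt_gen (Derive F) (at_right 0) (Rbar_locally p_infty)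
  (x * Gamma x - Gamma (x + 1))).
{ apply is_RInt_gen_ext with dF.
  - apply filter_imp with (2 := near). intros [a b] [ha hb] z; simpl in *.
    rewrite Rmin_left by lra. intros hz. symmetry. apply hdF; lra.
  - apply (is_RInt_gen_minus (V := R_NormedModule)).
    + apply (is_RInt_gen_scal (V := R_NormedModule)). now apply Gamma_spec.
    + apply Gamma_spec; lra. }
apply (is_RInt_gen_unique (V := R_CompleteNormedModule)) in h1, h2.
rewrite h1 in h2. lra.
Qed.

Lemma exp_convex s a b :
  0 <= s <= 1 -> exp (s * a + (1 - s) * b) <= s * exp a + (1 - s) * exp b.
Proof.
intros hs. set (m := s * a + (1 - s) * b).
assert (tangent : forall c, exp m * (1 + (c - m)) <= exp c).
{ intros c. replace (exp c) with (exp m * exp (c - m)).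
  - apply Rmult_le_compat_l; [left; apply exp_pos | apply exp_ineq1_le].
  - rewrite <- exp_plus. f_equal. ring. }
assert (ha := Rmult_le_compat_l s _ _ (proj1 hs) (tangent a)).
assert (hb := Rmult_le_compat_l (1 - s) _ _ ltac:(lra) (tangent b)).
replace (exp m) with
  (s * (exp m * (1 + (a - m))) + (1 - s) * (exp m * (1 + (b - m))));
  [lra | unfold m; ring].
Qed.

Definition convex_on_pos (f : R -> R) : Prop :=
  forall x y s, 0 < x -> 0 < y -> 0 <= s <= 1 ->
    f (s * x + (1 - s) * y) <= s * f x + (1 - s) * f y.

Definition ln_Gamma (x : R) : R := ln (Gamma x).

(** Hölder's inequality for the Gamma integrals, proved through Young's: after
    normalising the integrands at [x] and [y] to have integral 1, the convexity of
    the exponential bounds their weighted geometric mean by their weighted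
    arithmetic mean, whose integral is 1. *)
Lemma ln_Gamma_convex : convex_on_pos ln_Gamma.
Proof.
intros x y s hx hy hs.
set (z := s * x + (1 - s) * y).
set (c := s * ln_Gamma x + (1 - s) * ln_Gamma y).
assert (hz : 0 < z).
{ unfold z. destruct (Rle_lt_dec s (1 / 2)).
  - assert (0 < (1 - s) * y) by (apply Rmult_lt_0_compat; lra).
    assert (0 <= s * x) by (apply Rmult_le_pos; lra). lra.
  - assert (0 < s * x) by (apply Rmult_lt_0_compat; lra).
    assert (0 <= (1 - s) * y) by (apply Rmult_le_pos; lra). lra. }
assert (hGx := Gamma_gt0 x hx). assert (hGy := Gamma_gt0 y hy).
assert (hle : Gamma z <= exp c).
{ apply (proj2 (Gamma_spec z hz)). intros v (a & b & hab & ->).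
  set (g := fun t => scal (exp c * s / Gamma x) (gamma_integrand x t)
                   + scal (exp c * (1 - s) / Gamma y) (gamma_integrand y t)).
  assert (hx_int : ex_RInt (gamma_integrand x) a b)
    by (apply ex_RInt_gamma_integrand; lra).
  assert (hy_int : ex_RInt (gamma_integrand y) a b)
    by (apply ex_RInt_gamma_integrand; lra).
  assert (hIx : RInt (gamma_integrand x) a b <= Gamma x).
  { apply (proj2 (Gamma_spec x hx)). now exists a, b. }
  assert (hIy : RInt (gamma_integrand y) a b <= Gamma y).
  { apply (proj2 (Gamma_spec y hy)). now exists a, b. }
  apply Rle_trans with (RInt g a b).
  - apply RInt_le; [lra | apply ex_RInt_gamma_integrand; lra | |].
    + apply (ex_RInt_plus (V := R_NormedModule));
        now apply (ex_RInt_scal (V := R_NormedModule)).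
    + intros t ht. unfold g, scal; simpl; unfold mult; simpl.
      assert (hexp : forall w, 0 < w ->
        gamma_integrand w t / Gamma w = exp ((w - 1) * ln t - t - ln_Gamma w)).
      { intros w hw. unfold gamma_integrand, ln_Gamma, Rpower, Rminus.
        rewrite !exp_plus, (exp_Ropp (ln _)), exp_ln by now apply Gamma_gt0.
        reflexivity. }
      replace (gamma_integrand z t) with (exp c * exp
        (s * ((x - 1) * ln t - t - ln_Gamma x)
         + (1 - s) * ((y - 1) * ln t - t - ln_Gamma y))).
      * apply Rle_trans with (exp c * (s * (gamma_integrand x t / Gamma x)
          + (1 - s) * (gamma_integrand y t / Gamma y))).
        -- apply Rmult_le_compat_l; [left; apply exp_pos |].
           rewrite !hexp by assumption. now apply exp_convex.
        -- right. field. lra.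
      * unfold gamma_integrand, Rpower. rewrite <- !exp_plus. f_equal.
        unfold c, z. ring.
  - unfold g. rewrite (RInt_plus (V := R_CompleteNormedModule));
      try now apply (ex_RInt_scal (V := R_NormedModule)).
    rewrite !(RInt_scal (V := R_CompleteNormedModule)) by assumption.
    unfold plus, scal; simpl; unfold mult; simpl.
    assert (he := exp_pos c).
    apply Rle_trans with (exp c * s / Gamma x * Gamma x
                          + exp c * (1 - s) / Gamma y * Gamma y).
    + apply Rplus_le_compat; apply Rmult_le_compat_l; try assumption;
        (apply Rmult_le_pos; [apply Rmult_le_pos; lra |
                              left; apply Rinv_0_lt_compat; lra]).
    + right. field. lra. }
unfold ln_Gamma at 1. rewrite <- (ln_exp c).
apply ln_le; [now apply Gamma_gt0 | exact hle].
Qed.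

Lemma ln_Gamma_succ x : 0 < x -> ln_Gamma (x + 1) = ln_Gamma x + ln x.
Proof.
intros hx. unfold ln_Gamma. rewrite Gamma_succ by exact hx.
rewrite ln_mult; [ring | exact hx | now apply Gamma_gt0].
Qed.

(** * Differentiability of convex solutions of [f (x + 1) = f x + ln x] *)

Lemma ln_le_sub1 y : 0 < y -> ln y <= y - 1.
Proof. intros hy. generalize (exp_ineq1_le (ln y)). rewrite exp_ln; lra. Qed.

(** For a convex [f], the infimum of the admissible [eps] is the jump of the
    one-sided derivatives at [x]. *)
Definition almost_flat (f : R -> R) (eps x : R) : Prop :=
  exists delta, 0 < delta <= x /\
    forall h, 0 < h < delta -> f (x + h) + f (x - h) - 2 * f x <= eps * h.

(** The candidate derivative is the supremum of the left slopes.  By convexity no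
    left slope exceeds a right slope, so both difference quotients are within
    [right_slope h - left_slope h] of it, and this gap is the second difference
    divided by [h]. *)
Lemma almost_flat_is_derive f x :
  convex_on_pos f -> 0 < x -> (forall eps, 0 < eps -> almost_flat f eps x) ->
  exists d, is_derive f x d /\ d <= f (x + 1) - f x /\
    (1 < x -> f x - f (x - 1) <= d).
Proof.
intros f_conv hx f_flat.
set (left_slope := fun k => (f x - f (x - k)) / k).
set (right_slope := fun h => (f (x + h) - f x) / h).
assert (left_le_right : forall h k, 0 < h -> 0 < k < x ->
  left_slope k <= right_slope h).
{ intros h k hh hk.
  assert (hc : f x <= k / (h + k) * f (x + h) + (1 - k / (h + k)) * f (x - k)).
  { replace x with (k / (h + k) * (x + h) + (1 - k / (h + k)) * (x - k)) at 1
      by (field; lra).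
    apply f_conv; try lra. split.
    - left; apply Rdiv_lt_0_compat; lra.
    - apply Rmult_le_reg_r with (h + k); [lra |]. field_simplify; lra. }
  apply Rmult_le_compat_l with (r := (h + k) / (h * k)) in hc.
  - replace (right_slope h) with (left_slope k +
      ((h + k) / (h * k) * (k / (h + k) * f (x + h)
         + (1 - k / (h + k)) * f (x - k)) - (h + k) / (h * k) * f x)).
    + lra.
    + unfold left_slope, right_slope. field. lra.
  - left. apply Rdiv_lt_0_compat; [lra | apply Rmult_lt_0_compat; lra]. }
destruct (completeness (fun v => exists k, 0 < k < x /\ v = left_slope k))
  as [d [d_ub d_least]].
- exists (right_slope 1). intros v (k & hk & ->). apply left_le_right; lra.
- exists (left_slope (x / 2)), (x / 2). split; [lra | reflexivity].
- assert (left_le : forall k, 0 < k < x -> left_slope k <= d).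
  { intros k hk. apply d_ub. now exists k. }
  assert (le_right : forall h, 0 < h -> d <= right_slope h).
  { intros h hh. apply d_least. intros v (k & hk & ->). now apply left_le_right. }
  exists d. split; [| split].
  + apply is_derive_Reals. intros eps heps.
    destruct (f_flat (eps / 2) ltac:(lra)) as (delta & hdelta & hflat).
    assert (gap : forall h, 0 < h < delta -> right_slope h - left_slope h < eps).
    { intros h hh. apply Rle_lt_trans with (eps / 2); [| lra].
      apply Rmult_le_reg_r with h; [lra |].
      replace ((right_slope h - left_slope h) * h)
        with (f (x + h) + f (x - h) - 2 * f x)
        by (unfold right_slope, left_slope; field; lra).
      now apply hflat. }
    exists (mkposreal delta (proj1 hdelta)). simpl. intros h hn0 hh.
    apply Rabs_lt_between in hh. apply Rabs_lt_between.
    destruct (Rlt_le_dec 0 h) as [hpos | hneg].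
    * change ((f (x + h) - f x) / h) with (right_slope h).
      generalize (gap h ltac:(lra)) (left_le h ltac:(lra)) (le_right h ltac:(lra)).
      lra.
    * replace ((f (x + h) - f x) / h) with (left_slope (- h)).
      -- generalize (gap (- h) ltac:(lra)) (left_le (- h) ltac:(lra))
           (le_right (- h) ltac:(lra)). lra.
      -- unfold left_slope. replace (x - - h) with (x + h) by ring. field. lra.
  + replace (f (x + 1) - f x) with (right_slope 1)
      by (unfold right_slope; field).
    apply le_right; lra.
  + intros hx1. replace (f x - f (x - 1)) with (left_slope 1)
      by (unfold left_slope; field).
    apply left_le; lra.
Qed.

Definition log_recurrence (f : R -> R) : Prop :=
  forall x, 0 < x -> f (x + 1) = f x + ln x.

(** By convexity the slopes over steps [h <= 1] on the two sides of [x] are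
    bounded by the unit slopes [ln x] and [ln (x - 1)], which nearly agree when
    [x] is large. *)
Lemma almost_flat_far f x :
  convex_on_pos f -> log_recurrence f -> 1 < x -> almost_flat f (/ (x - 1)) x.
Proof.
intros f_conv f_rec hx. exists 1. split; [lra |]. intros h hh.
assert (hr := f_conv (x + 1) x h ltac:(lra) ltac:(lra) ltac:(lra)).
assert (hl := f_conv (x - 1) x h ltac:(lra) ltac:(lra) ltac:(lra)).
replace (h * (x + 1) + (1 - h) * x) with (x + h) in hr by ring.
replace (h * (x - 1) + (1 - h) * x) with (x - h) in hl by ring.
rewrite (f_rec x) in hr by lra.
assert (hx' := f_rec (x - 1) ltac:(lra)).
replace (x - 1 + 1) with x in hx' by ring.
assert (hln : ln x - ln (x - 1) <= / (x - 1)).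
{ rewrite <- ln_div by lra.
  generalize (ln_le_sub1 (x / (x - 1)) ltac:(apply Rdiv_lt_0_compat; lra)).
  replace (x / (x - 1) - 1) with (/ (x - 1)) by (field; lra). trivial. }
apply Rmult_le_compat_l with (r := h) in hln; [| lra].
replace (f (x - 1)) with (f x - ln (x - 1)) in hl by lra.
lra.
Qed.

(** Passing from [x + 1] to [x] subtracts the second difference of [ln] at [x],
    which is of order [h^2] and so costs an arbitrarily small increase of
    [eps]. *)
Lemma almost_flat_pred f x eps eps' :
  log_recurrence f -> 0 < x -> eps < eps' ->
  almost_flat f eps (x + 1) -> almost_flat f eps' x.
Proof.
intros f_rec hx heps (delta & hdelta & hflat).
(* The second difference of ln at x is at least - h^2 / (x^2 - h^2).  For
   h < x / 2 and h < c this is at least - (eps' - eps) * h. *)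
set (c := (eps' - eps) * x ^ 2 / 2).
assert (hx2 : 0 < x ^ 2) by (apply pow_lt; lra).
assert (hc : 0 < c).
{ unfold c. apply Rdiv_lt_0_compat; [apply Rmult_lt_0_compat; lra | lra]. }
exists (Rmin delta (Rmin (x / 2) c)). split.
{ split.
  - repeat apply Rmin_glb_lt; lra.
  - apply Rle_trans with (1 := Rmin_r _ _). apply Rle_trans with (1 := Rmin_l _ _).
    lra. }
intros h [hh0 hh].
assert (hh1 := Rlt_le_trans _ _ _ hh (Rmin_l _ _)).
assert (hh' := Rlt_le_trans _ _ _ hh (Rmin_r _ _)).
assert (hh2 := Rlt_le_trans _ _ _ hh' (Rmin_l _ _)).
assert (hh3 := Rlt_le_trans _ _ _ hh' (Rmin_r _ _)).
assert (hf := hflat h ltac:(lra)).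
replace (x + 1 + h) with (x + h + 1) in hf by ring.
replace (x + 1 - h) with (x - h + 1) in hf by ring.
rewrite !f_rec in hf by lra.
assert (hprod : 0 < (x + h) * (x - h)) by (apply Rmult_lt_0_compat; lra).
assert (hln : 2 * ln x - ln (x + h) - ln (x - h) <= (eps' - eps) * h).
{ replace (2 * ln x - ln (x + h) - ln (x - h))
    with (ln (x * x / ((x + h) * (x - h)))).
  - apply Rle_trans with (x * x / ((x + h) * (x - h)) - 1).
    { apply ln_le_sub1, Rdiv_lt_0_compat; [apply Rmult_lt_0_compat; lra | lra]. }
    apply Rmult_le_reg_r with ((x + h) * (x - h)); [lra |].
    replace ((x * x / ((x + h) * (x - h)) - 1) * ((x + h) * (x - h)))
      with (h * h) by (field; lra).
    apply Rle_trans with (h * c); [apply Rmult_le_compat_l; lra |].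
    replace ((eps' - eps) * h * ((x + h) * (x - h)))
      with (h * ((eps' - eps) * (x ^ 2 - h ^ 2))) by ring.
    apply Rmult_le_compat_l; [lra |].
    unfold c, Rdiv. rewrite Rmult_assoc. apply Rmult_le_compat_l; [lra |].
    assert (h ^ 2 <= (x / 2) ^ 2) by (apply pow_incr; lra). nra.
  - rewrite ln_div, !ln_mult by nra. lra. }
lra.
Qed.

Lemma convex_log_recurrence_almost_flat f x eps :
  convex_on_pos f -> log_recurrence f -> 0 < x -> 0 < eps -> almost_flat f eps x.
Proof.
intros f_conv f_rec hx heps.
assert (descend : forall n y e e', 0 < y -> e < e' ->
  almost_flat f e (y + INR n) -> almost_flat f e' y).
{ induction n as [| n IH]; intros y e e' hy he.
  - simpl. rewrite Rplus_0_r. intros (delta & hdelta & hflat).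
    exists delta. split; [exact hdelta |]. intros h hh.
    apply Rle_trans with (1 := hflat h hh). apply Rmult_le_compat_r; lra.
  - rewrite S_INR. replace (y + (INR n + 1)) with (y + 1 + INR n) by ring.
    intros hflat. apply (almost_flat_pred f y ((e + e') / 2)); try assumption; [lra |].
    apply (IH (y + 1) e); [lra | lra | exact hflat]. }
(* Far out the flatness constant is below eps / 2, which leaves room for the
   losses on the way back to x. *)
destruct (nfloor_ex (1 + 2 / eps)) as [n hn].
{ assert (0 < 2 / eps) by (apply Rdiv_lt_0_compat; lra). lra. }
assert (h2 : 0 < 2 / eps) by (apply Rdiv_lt_0_compat; lra).
apply (descend (S n) x (/ (x + INR (S n) - 1))); [exact hx | |].
- rewrite S_INR. apply Rle_lt_trans with (eps / 2); [| lra].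
  replace (eps / 2) with (/ (2 / eps)) by (field; lra).
  apply Rinv_le_contravar; lra.
- apply almost_flat_far; try assumption. rewrite S_INR. lra.
Qed.

(** * The logarithmic derivatives of [Gamma] and [r] *)

(** The bounds are the unit slopes of the convex function [ln_Gamma] to the right
    and to the left of [x]. *)
Lemma is_derive_ln_Gamma x :
  0 < x ->
  is_derive ln_Gamma x (Derive ln_Gamma x) /\ Derive ln_Gamma x <= ln x /\
  (1 < x -> ln (x - 1) <= Derive ln_Gamma x).
Proof.
intros hx.
destruct (almost_flat_is_derive ln_Gamma x ln_Gamma_convex hx) as (d & hd & hr & hl).
{ intros eps heps. apply convex_log_recurrence_almost_flat; try assumption.
  - exact ln_Gamma_convex.
  - exact ln_Gamma_succ. }
rewrite (is_derive_unique _ _ _ hd). split; [exact hd | split].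
- rewrite ln_Gamma_succ in hr by exact hx. lra.
- intros hx1. specialize (hl hx1).
  assert (hs := ln_Gamma_succ (x - 1) ltac:(lra)).
  replace (x - 1 + 1) with x in hs by ring. lra.
Qed.

Lemma locally_pos x : 0 < x -> locally x (fun y => 0 < y).
Proof.
intros hx. exists (mkposreal x hx). intros y hy.
apply Rabs_lt_between in hy. unfold minus, plus, opp in hy; simpl in hy. lra.
Qed.

Lemma digamma_ln_Gamma x : 0 < x -> digamma x = Derive ln_Gamma x.
Proof.
intros hx. unfold digamma.
assert (h : is_derive Gamma x (Gamma x * Derive ln_Gamma x)).
{ apply is_derive_ext_loc with (fun y => exp (ln_Gamma y)).
  - apply filter_imp with (2 := locally_pos x hx). intros y hy.
    apply exp_ln, Gamma_gt0, hy.
  - rewrite Rmult_comm. rewrite <- (exp_ln (Gamma x)) by now apply Gamma_gt0.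
    apply (is_derive_comp exp ln_Gamma).
    + apply is_derive_exp.
    + now apply is_derive_ln_Gamma. }
rewrite (is_derive_unique _ _ _ h). field.
generalize (Gamma_gt0 x hx). lra.
Qed.

Lemma digamma_succ x : 0 < x -> digamma (x + 1) = digamma x + / x.
Proof.
intros hx. rewrite !digamma_ln_Gamma by lra.
assert (h1 : is_derive (fun y => ln_Gamma (y + 1)) x (Derive ln_Gamma (x + 1))).
{ rewrite <- (Rmult_1_l (Derive ln_Gamma (x + 1))).
  apply (is_derive_comp ln_Gamma (fun y => y + 1)).
  - apply is_derive_ln_Gamma; lra.
  - auto_derive; [exact I | ring]. }
assert (h2 : is_derive (fun y => ln_Gamma (y + 1)) x (Derive ln_Gamma x + / x)).
{ apply is_derive_ext_loc with (fun y => ln_Gamma y + ln y).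
  - apply filter_imp with (2 := locally_pos x hx). intros y hy.
    symmetry. now apply ln_Gamma_succ.
  - apply (is_derive_plus (V := R_NormedModule)).
    + now apply is_derive_ln_Gamma.
    + now apply is_derive_ln. }
apply is_derive_unique in h1, h2. now rewrite h1 in h2.
Qed.

Definition dlnr_digamma (p : R) : R :=
  (digamma ((p + 1) / 2) - digamma (p / 2)) / 2 - / (2 * p).

Lemma is_derive_ln_r p :
  0 < p -> is_derive (fun q => ln (r q)) p (dlnr_digamma p).
Proof.
intros hp.
assert (hr : forall q, 0 < q ->
  ln (2 / q) / 2 + ln_Gamma ((q + 1) / 2) - ln_Gamma (q / 2) = ln (r q)).
{ intros q hq.
  assert (hG1 := Gamma_gt0 ((q + 1) / 2) ltac:(lra)).
  assert (hG2 := Gamma_gt0 (q / 2) ltac:(lra)).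
  assert (h2q : 0 < 2 / q) by (apply Rdiv_lt_0_compat; lra).
  unfold r. rewrite (ln_mult (sqrt (2 / q))), (ln_div (Gamma _)), <- Rpower_sqrt
    by (repeat first [assumption | apply sqrt_lt_R0 | apply Rdiv_lt_0_compat]).
  unfold Rpower, ln_Gamma. rewrite ln_exp. field. }
apply is_derive_ext_loc with (1 := filter_imp _ _ hr (locally_pos p hp)).
unfold dlnr_digamma. rewrite !digamma_ln_Gamma by lra.
destruct (is_derive_ln_Gamma ((p + 1) / 2) ltac:(lra)) as [h1 _].
destruct (is_derive_ln_Gamma (p / 2) ltac:(lra)) as [h2 _].
auto_derive.
- repeat split; try lra; [apply Rdiv_lt_0_compat; lra | |];
    eexists; [exact h1 | exact h2].
- replace (fun x : R => ln_Gamma x) with ln_Gamma by reflexivity.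
  unfold Rdiv. field. lra.
Qed.

Lemma dlnr_eq p : 0 < p -> dlnr p = dlnr_digamma p.
Proof. intros hp. now apply is_derive_unique, is_derive_ln_r. Qed.

(** The arguments [(p + 1) / 2] cancel, and [p / 2 + 1] differs from [p / 2] by one
    step of the digamma recurrence. *)
Lemma dlnr_add_succ p : 0 < p -> dlnr p + dlnr (p + 1) = / (2 * p * (p + 1)).
Proof.
intros hp. rewrite !dlnr_eq by lra. unfold dlnr_digamma.
replace ((p + 1 + 1) / 2) with (p / 2 + 1) by field.
rewrite (digamma_succ (p / 2)) by lra. field. lra.
Qed.

(** This supplies the decay of [dlnr] at infinity. *)
Lemma dlnr_bound p : 2 < p -> Rabs (dlnr p) <= 2 / (p - 2).
Proof.
intros hp. rewrite dlnr_eq by lra. unfold dlnr_digamma.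
rewrite !digamma_ln_Gamma by lra.
destruct (is_derive_ln_Gamma ((p + 1) / 2) ltac:(lra)) as (_ & u1 & l1).
destruct (is_derive_ln_Gamma (p / 2) ltac:(lra)) as (_ & u2 & l2).
specialize (l1 ltac:(lra)). specialize (l2 ltac:(lra)).
assert (h1 : ln ((p + 1) / 2) - ln (p / 2 - 1) <= 3 / (p - 2)).
{ rewrite <- ln_div by lra.
  replace (3 / (p - 2)) with ((p + 1) / 2 / (p / 2 - 1) - 1) by (field; lra).
  apply ln_le_sub1, Rdiv_lt_0_compat; lra. }
assert (h2 : ln (p / 2) - ln ((p + 1) / 2 - 1) <= 1 / (p - 1)).
{ rewrite <- ln_div by lra.
  replace (1 / (p - 1)) with (p / 2 / ((p + 1) / 2 - 1) - 1) by (field; lra).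
  apply ln_le_sub1, Rdiv_lt_0_compat; lra. }
assert (h3 : / (p - 1) <= / (p - 2)) by (apply Rinv_le_contravar; lra).
assert (h4 : / (2 * p) <= / (p - 2)) by (apply Rinv_le_contravar; lra).
assert (h5 : 0 < / (2 * p)) by (apply Rinv_0_lt_compat; lra).
apply Rabs_le. unfold Rdiv in *. lra.
Qed.

(** * The series *)

(** This is the Beta value [B(p, m + 1)], the integral of [t^(p-1) (1-t)^m] over
    [(0, 1)], which explains its monotonicity and [fact_ratio_shift]. *)
Definition fact_ratio (p : R) (m : nat) : R := INR (fact m) / pochhammer p (m + 1).

Lemma pochhammer_gt0 p m : 0 < p -> 0 < pochhammer p m.
Proof.
intros hp. induction m as [| m IH]; simpl; [lra |].
apply Rmult_lt_0_compat; [exact IH | generalize (pos_INR m); lra].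
Qed.

Lemma fact_ratio_gt0 p m : 0 < p -> 0 < fact_ratio p m.
Proof.
intros hp. apply Rdiv_lt_0_compat; [apply INR_fact_lt_0 | now apply pochhammer_gt0].
Qed.

Lemma fact_ratio_0 p : 0 < p -> fact_ratio p 0 = / p.
Proof. intros hp. unfold fact_ratio. simpl. field. lra. Qed.

Lemma fact_ratio_S p m :
  0 < p ->
  fact_ratio p (S m) = fact_ratio p m * (INR m + 1) / (p + INR m + 1).
Proof.
intros hp. unfold fact_ratio. rewrite fact_simpl, mult_INR, !Nat.add_1_r.
change (pochhammer p (S (S m))) with (pochhammer p (S m) * (p + INR (S m))).
rewrite S_INR. field. generalize (pos_INR m) (pochhammer_gt0 p (S m) hp).
intros; split; lra.
Qed.

Lemma fact_ratio_decr p m : 0 < p -> fact_ratio p (S m) < fact_ratio p m.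
Proof.
intros hp. assert (hT := fact_ratio_gt0 p m hp). assert (hm := pos_INR m).
rewrite fact_ratio_S by exact hp.
apply Rmult_lt_reg_r with (p + INR m + 1); [lra |].
unfold Rdiv. rewrite Rmult_assoc, Rinv_l, Rmult_1_r by lra.
apply Rmult_lt_compat_l; lra.
Qed.

Lemma fact_ratio_le p m j : 0 < p -> fact_ratio p (m + j) <= fact_ratio p m.
Proof.
intros hp. induction j as [| j IH].
- rewrite Nat.add_0_r. lra.
- rewrite Nat.add_succ_r. generalize (fact_ratio_decr p (m + j) hp). lra.
Qed.

(** In the Beta integral this is [t (1-t)^m = (1-t)^m - (1-t)^(m+1)]. *)
Lemma fact_ratio_shift p m :
  0 < p -> fact_ratio (p + 1) m = fact_ratio p m - fact_ratio p (S m).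
Proof.
intros hp. induction m as [| m IH].
- rewrite fact_ratio_S, !fact_ratio_0 by lra. simpl. field. lra.
- assert (hm := pos_INR m).
  rewrite fact_ratio_S, IH, (fact_ratio_S p (S m)), !(fact_ratio_S p m) by lra.
  rewrite S_INR. field. lra.
Qed.

Lemma ell_term_fact_ratio p m : ell_term p m = (/ 2) ^ S m * fact_ratio p m.
Proof.
unfold ell_term, fact_ratio. rewrite pow_inv. unfold Rdiv. simpl (1 + m)%nat.
ring.
Qed.

Lemma ell_term_gt0 p m : 0 < p -> 0 < ell_term p m.
Proof.
intros hp. rewrite ell_term_fact_ratio.
apply Rmult_lt_0_compat; [apply pow_lt; lra | now apply fact_ratio_gt0].
Qed.

Lemma is_series_half_pow c n :
  is_series (fun j => (/ 2) ^ S (S n + j) * c) ((/ 2) ^ S n * c).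
Proof.
assert (h : is_series (fun j => (/ 2) ^ j) (/ (1 - / 2)))
  by (apply is_series_geom; rewrite Rabs_pos_eq; lra).
apply (is_series_scal_l ((/ 2) ^ S (S n) * c)) in h.
replace ((/ 2) ^ S n * c) with ((/ 2) ^ S (S n) * c * / (1 - / 2)).
- apply is_series_ext with (2 := h). intros j.
  rewrite <- Nat.add_succ_l, pow_add.
  change ((/ 2) ^ S (S n) * c * (/ 2) ^ j = (/ 2) ^ S (S n) * (/ 2) ^ j * c). ring.
- simpl. field.
Qed.

Lemma ell_term_tail_le p n j :
  0 < p -> ell_term p (S n + j) <= (/ 2) ^ S (S n + j) * fact_ratio p (S n).
Proof.
intros hp. rewrite ell_term_fact_ratio.
apply Rmult_le_compat_l; [apply pow_le; lra | now apply fact_ratio_le].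
Qed.

Lemma ex_series_ell_term_tail p n :
  0 < p -> ex_series (fun j => ell_term p (S n + j)).
Proof.
intros hp.
apply (ex_series_le (K := R_AbsRing) (V := R_CompleteNormedModule))
  with (fun j => (/ 2) ^ S (S n + j) * fact_ratio p (S n)).
- intros j. change (Rabs (ell_term p (S n + j)) <=
    (/ 2) ^ S (S n + j) * fact_ratio p (S n)).
  rewrite Rabs_pos_eq by (left; now apply ell_term_gt0).
  now apply ell_term_tail_le.
- eexists. apply is_series_half_pow.
Qed.

Lemma Series_ge_term (a : nat -> R) N :
  (forall n, 0 <= a n) -> ex_series a -> a N <= Series a.
Proof.
revert a. induction N as [| N IH]; intros a a_ge0 a_cv;
  rewrite Series_incr_1 by exact a_cv.
- assert (h : Series (fun _ => 0) <= Series (fun k => a (S k))).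
  { apply Series_le; [intros n; split; [lra | apply a_ge0] |].
    now apply ex_series_incr_1 in a_cv. }
  rewrite (Series_ext _ (fun n => 0 * a n)), Series_scal_l in h by (intros; ring).
  lra.
- apply Rle_trans with (Series (fun k => a (S k))).
  + apply (IH (fun k => a (S k))); [intros; apply a_ge0 |].
    now apply ex_series_incr_1 in a_cv.
  + generalize (a_ge0 0%nat). lra.
Qed.

Lemma Series_lt (a b : nat -> R) N :
  (forall n, a n <= b n) -> a N < b N -> ex_series a -> ex_series b ->
  Series a < Series b.
Proof.
intros hle hlt a_cv b_cv.
assert (h : b N - a N <= Series (fun n => b n - a n)).
{ apply (Series_ge_term (fun n => b n - a n)).
  - intros n. generalize (hle n). lra.
  - now apply (ex_series_minus (V := R_NormedModule)). }
rewrite Series_minus in h by assumption. lra.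
Qed.

Definition ell_tail (p : R) (n : nat) : R := Series (fun j => ell_term p (S n + j)).

Lemma ell_S (n : nat) p : ell (S n) p = ell n p + ell_term p (S n).
Proof. simpl. rewrite sum_n_Sm by lia. reflexivity. Qed.

Lemma ell_inf_split (n : nat) p : 0 < p -> ell ninf p = ell n p + ell_tail p n.
Proof.
intros hp. induction n as [| n IH].
- simpl ell. rewrite sum_n_m_zero by lia. unfold zero, ell_tail; simpl. ring.
- rewrite IH, ell_S. unfold ell_tail at 1.
  rewrite Series_incr_1 by now apply ex_series_ell_term_tail.
  rewrite Nat.add_0_r, Rplus_assoc. do 2 f_equal.
  apply Series_ext. intros j. f_equal. lia.
Qed.

Lemma ell_tail_gt0 p n : 0 < p -> 0 < ell_tail p n.
Proof.
intros hp. apply Rlt_le_trans with (ell_term p (S n + 0)).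
- now apply ell_term_gt0.
- apply (Series_ge_term (fun j => ell_term p (S n + j))).
  + intros j. left. now apply ell_term_gt0.
  + now apply ex_series_ell_term_tail.
Qed.

(** This becomes the comparison of the upper error with the lower one. *)
Lemma ell_tail_shift_lt p n : 0 < p -> ell_tail (p + 1) n < ell_tail p n.
Proof.
intros hp.
assert (hlt : forall m, ell_term (p + 1) m < ell_term p m).
{ intros m. rewrite !ell_term_fact_ratio. apply Rmult_lt_compat_l.
  - apply pow_lt; lra.
  - rewrite fact_ratio_shift by exact hp.
    generalize (fact_ratio_gt0 p (S m) hp). lra. }
apply (Series_lt _ _ 0).
- intros j. left. apply hlt.
- apply hlt.
- apply ex_series_ell_term_tail; lra.
- now apply ex_series_ell_term_tail.
Qed.

(** Bounding every factor [fact_ratio p m] in the tail by the first one leaves a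
    geometric series. *)
Lemma ell_tail_lt p n : 0 < p -> ell_tail p n < (/ 2) ^ S n * fact_ratio p (S n).
Proof.
intros hp. rewrite <- (is_series_unique _ _ (is_series_half_pow _ _)).
apply (Series_lt _ _ 1).
- intros j. now apply ell_term_tail_le.
(* The comparison is an equality at index 0, hence strictness at index 1. *)
- rewrite ell_term_fact_ratio. apply Rmult_lt_compat_l; [apply pow_lt; lra |].
  rewrite Nat.add_1_r. now apply fact_ratio_decr.
- now apply ex_series_ell_term_tail.
- eexists. apply is_series_half_pow.
Qed.

Lemma fact_ratio_S_lt p m : 0 < p -> fact_ratio p (S m) < / p.
Proof.
intros hp. rewrite <- fact_ratio_0 by exact hp.
apply Rlt_le_trans with (fact_ratio p m); [now apply fact_ratio_decr |].
now apply (fact_ratio_le p 0).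
Qed.

(** With [c m = 2^-m fact_ratio p m], the [m]-th summands at [p] and [p + 1] add up to
    [c m - c (m + 1)]; since [c] tends to 0, the sum from [m = 1] on is [c 1]. *)
Lemma ell_inf_add_succ p :
  0 < p -> ell ninf p + ell ninf (p + 1) = / (2 * p * (p + 1)).
Proof.
intros hp. simpl ell.
rewrite <- Series_plus by (apply (ex_series_ell_term_tail _ 0); lra).
set (c := fun m => (/ 2) ^ m * fact_ratio p m).
assert (hc0 : is_lim_seq c 0).
{ apply is_lim_seq_le_le with (fun _ => 0) (fun m => (/ 2) ^ m * / p).
  - intros m. unfold c. assert (h2 : 0 < (/ 2) ^ m) by (apply pow_lt; lra).
    split.
    + left. apply Rmult_lt_0_compat; [exact h2 | now apply fact_ratio_gt0].
    + apply Rmult_le_compat_l; [lra |]. rewrite <- fact_ratio_0 by exact hp.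
      now apply (fact_ratio_le p 0).
  - apply is_lim_seq_const.
  - replace (Finite 0) with (Rbar_mult (Finite 0) (Finite (/ p)))
      by (simpl; f_equal; ring).
    apply is_lim_seq_scal_r, is_lim_seq_geom. rewrite Rabs_pos_eq; lra. }
apply is_series_unique.
replace (/ (2 * p * (p + 1))) with (c 1%nat - 0).
- apply (is_lim_seq_ext (fun n => c 1%nat - c (S (S n))) (sum_n _) (c 1%nat - 0)).
  + intros n. apply eq_sym. induction n as [| n IH].
    * rewrite sum_O, !ell_term_fact_ratio, (fact_ratio_shift p 1) by exact hp.
      unfold c. cbn [pow]. lra.
    * rewrite sum_Sn, IH, !ell_term_fact_ratio, (fact_ratio_shift p) by exact hp.
      unfold c. change plus with Rplus. cbn [pow]. lra.
  + apply (is_lim_seq_minus' (fun _ => c 1%nat)); [apply is_lim_seq_const |].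
    now apply is_lim_seq_incr_1, (is_lim_seq_incr_1 (fun n => c (S n))) in hc0.
- unfold c. rewrite fact_ratio_S, fact_ratio_0 by exact hp. simpl. field. lra.
Qed.

(** * Identification of the series and the inequalities *)

Lemma antiperiodic_vanishing (h : R -> R) K :
  (forall p, 0 < p -> h (p + 1) = - h p) ->
  (forall p, 2 < p -> Rabs (h p) <= K / (p - 2)) ->
  forall p, 0 < p -> h p = 0.
Proof.
intros h_anti h_bound p hp.
assert (h_abs : forall n : nat, Rabs (h (p + INR n)) = Rabs (h p)).
{ induction n as [| n IH].
  - simpl. now rewrite Rplus_0_r.
  - rewrite S_INR, <- Rplus_assoc, h_anti, Rabs_Ropp, IH;
      [reflexivity | generalize (pos_INR n); lra]. }
destruct (Req_dec (h p) 0) as [h0 | h0]; [exact h0 | exfalso].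
apply Rabs_pos_lt in h0.
set (T := Rmax 0 (K / Rabs (h p))).
assert (hT0 : 0 <= T) by apply Rmax_l.
assert (hT1 : K / Rabs (h p) <= T) by apply Rmax_r.
destruct (nfloor_ex (2 + T)) as [n hn]; [lra |].
assert (hb := h_bound (p + INR (S n)) ltac:(rewrite S_INR; lra)).
rewrite h_abs, S_INR in hb.
set (d := p + (INR n + 1) - 2) in hb.
assert (hd : T < d) by (unfold d; lra).
assert (hb' : Rabs (h p) * d <= K).
{ apply Rmult_le_compat_r with (r := d) in hb; [| lra].
  replace (K / d * d) with K in hb by (field; lra). exact hb. }
assert (hK : K < d * Rabs (h p)).
{ replace K with (K / Rabs (h p) * Rabs (h p)) by (field; lra).
  apply Rmult_lt_compat_r; lra. }
lra.
Qed.

(** Both sides solve the same first-order recurrence and vanish at infinity. *)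
Lemma ell_inf_dlnr p : 0 < p -> ell ninf p = dlnr p.
Proof.
intros hp. apply Rminus_diag_uniq. revert p hp.
apply (antiperiodic_vanishing (fun q => ell ninf q - dlnr q) 3).
- intros q hq. generalize (ell_inf_add_succ q hq) (dlnr_add_succ q hq). lra.
- intros q hq. assert (hd := dlnr_bound q hq).
  assert (hl : 0 < ell ninf q < / q).
  { rewrite (ell_inf_split 0 q) by lra. simpl ell.
    rewrite sum_n_m_zero by lia. unfold zero; simpl.
    generalize (ell_tail_gt0 q 0 ltac:(lra)) (ell_tail_lt q 0 ltac:(lra))
      (fact_ratio_S_lt q 0 ltac:(lra)) (fact_ratio_gt0 q 1 ltac:(lra)).
    simpl. lra. }
  assert (hi : / q <= / (q - 2)) by (apply Rinv_le_contravar; lra).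
  apply Rabs_le_between in hd. apply Rabs_le. unfold Rdiv in *. lra.
Qed.

Lemma dlnr_sub_ell (k : nat) p : 0 < p -> dlnr p - ell k p = ell_tail p k.
Proof. intros hp. rewrite <- ell_inf_dlnr, (ell_inf_split k) by exact hp. ring. Qed.

(** The functional equation of [dlnr] turns an upper approximation at [p] into a
    lower one at [p + 1]. *)
Lemma u_eq (k : natbar) p : 0 < p -> u k p = dlnr p + (dlnr (p + 1) - ell k (p + 1)).
Proof.
intros hp. unfold u, Rdiv. rewrite Rmult_1_l, <- dlnr_add_succ by exact hp. ring.
Qed.

Lemma ell_tail_S p n : 0 < p -> ell_tail p (S n) < ell_tail p n.
Proof.
intros hp. assert (h := ell_inf_split n p hp).
rewrite (ell_inf_split (S n)), ell_S in h by exact hp.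
generalize (ell_term_gt0 p (S n) hp). lra.
Qed.

Lemma error_bound_fact_ratio p (k : nat) :
  / 2 ^ (k + 1) * INR (fact (k + 1)) / pochhammer p (k + 2)
    = (/ 2) ^ S k * fact_ratio p (S k).
Proof.
unfold fact_ratio, Rdiv. rewrite pow_inv, !Nat.add_1_r.
replace (k + 2)%nat with (S (S k)) by lia. ring.
Qed.

Lemma ell_u_chain p (k : nat) :
  0 < p ->
  ell k p < ell (S k) p /\ ell (S k) p < ell ninf p /\ ell ninf p = dlnr p /\
  dlnr p = u ninf p /\ u ninf p < u (S k) p /\ u (S k) p < u k p.
Proof.
intros hp. rewrite ell_S, !u_eq, !dlnr_sub_ell by lra.
rewrite <- (ell_inf_dlnr (p + 1)), <- (ell_inf_dlnr p) by lra.
assert (h := ell_inf_split (S k) p hp). rewrite ell_S in h.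
generalize (ell_term_gt0 p (S k) hp) (ell_tail_gt0 p (S k) hp)
  (ell_tail_gt0 (p + 1) (S k) ltac:(lra)) (ell_tail_S (p + 1) k ltac:(lra)).
repeat split; lra.
Qed.

Lemma error_chain p (k : nat) :
  0 < p ->
  0 < u k p - dlnr p /\
  u k p - dlnr p < dlnr p - ell k p /\
  dlnr p - ell k p < / 2 ^ (k + 1) * INR (fact (k + 1)) / pochhammer p (k + 2) /\
  / 2 ^ (k + 1) * INR (fact (k + 1)) / pochhammer p (k + 2) < / 2 ^ (k + 1) / p.
Proof.
intros hp. rewrite error_bound_fact_ratio, u_eq, !dlnr_sub_ell by lra.
replace (/ 2 ^ (k + 1) / p) with ((/ 2) ^ S k * / p)
  by (rewrite pow_inv, Nat.add_1_r; reflexivity).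
replace (dlnr p + ell_tail (p + 1) k - dlnr p) with (ell_tail (p + 1) k) by ring.
split; [apply ell_tail_gt0; lra |]. split; [now apply ell_tail_shift_lt |].
split; [now apply ell_tail_lt |].
apply Rmult_lt_compat_l; [apply pow_lt; lra | now apply fact_ratio_S_lt].
Qed.

Lemma digamma_diff_dlnr x :
  - (1 / 2) < x ->
  digamma (x + 1) - digamma (x + 1 / 2) = 1 / (2 * x + 1) + 2 * dlnr (2 * x + 1).
Proof.
intros hx. rewrite dlnr_eq by lra. unfold dlnr_digamma.
replace ((2 * x + 1 + 1) / 2) with (x + 1) by field.
replace ((2 * x + 1) / 2) with (x + 1 / 2) by field.
field. lra.
Qed.

Lemma errors_vanish_dominated (e : nat -> R -> R) :
  (forall k p, 0 < p -> 0 <= e k p <= / 2 ^ (k + 1) / p) -> errors_vanish e.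
Proof.
intros he. split.
- intros p0 hp0. exists (/ p0), (/ 2).
  split; [now apply Rinv_0_lt_compat |]. split; [lra |].
  intros k p hp. destruct (he k p ltac:(lra)) as [he0 he1].
  rewrite Rabs_pos_eq by exact he0. apply Rle_trans with (1 := he1).
  rewrite <- pow_inv, Nat.add_1_r. simpl.
  assert (h2 : 0 < (/ 2) ^ k) by (apply pow_lt; lra).
  assert (hi : / p <= / p0) by (apply Rinv_le_contravar; lra).
  assert (hp' : 0 < / p) by (apply Rinv_0_lt_compat; lra).
  rewrite (Rmult_comm (/ p0)). unfold Rdiv. apply Rmult_le_compat; lra.
- intros k.
  apply is_lim_le_le_loc with (fun _ => 0) (fun p => / 2 ^ (k + 1) * / p).
  + exists 0. intros p hp. now apply he.
  + apply is_lim_const.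
  + replace (Finite 0) with (Rbar_mult (/ 2 ^ (k + 1)) (Rbar_inv p_infty))
      by (simpl; f_equal; ring).
    apply is_lim_scal_l, is_lim_inv; [apply is_lim_id | discriminate].
Qed.

Theorem proposition1p3 :
  (forall p : R, 0 < p ->
     ex_series (fun j : nat => ell_term p (S j)) /\
     ex_derive (fun q : R => ln (r q)) p) /\
  (forall (p : R) (k : nat), 0 < p ->
     ell k p < ell (S k) p /\
     ell (S k) p < ell ninf p /\
     ell ninf p = dlnr p /\
     dlnr p = u ninf p /\
     u ninf p < u (S k) p /\
     u (S k) p < u k p) /\
  (forall (x : R) (k : nat), - (1 / 2) < x ->
     ell_tilde k x < ell_tilde (S k) x /\
     ell_tilde (S k) x < ell_tilde ninf x /\
     ell_tilde ninf x = digamma (x + 1) - digamma (x + 1 / 2) /\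
     digamma (x + 1) - digamma (x + 1 / 2) = u_tilde ninf x /\
     u_tilde ninf x < u_tilde (S k) x /\
     u_tilde (S k) x < u_tilde k x) /\
  (forall (p : R) (k : nat), 0 < p ->
     0 < u k p - dlnr p /\
     u k p - dlnr p < dlnr p - ell k p /\
     dlnr p - ell k p
       < / 2 ^ (k + 1) * INR (fact (k + 1)) / pochhammer p (k + 2) /\
     / 2 ^ (k + 1) * INR (fact (k + 1)) / pochhammer p (k + 2)
       < / 2 ^ (k + 1) / p) /\
  errors_vanish (fun k p => / 2 ^ (k + 1) / p) /\
  errors_vanish
    (fun k p => / 2 ^ (k + 1) * INR (fact (k + 1)) / pochhammer p (k + 2)) /\
  errors_vanish (fun k p => dlnr p - ell k p) /\
  errors_vanish (fun k p => u k p - dlnr p).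
Proof.
split; [| split; [| split; [| split; [| split; [| split; [| split]]]]]].
- intros p hp. split; [now apply (ex_series_ell_term_tail p 0) |].
  eexists. now apply is_derive_ln_r.
- intros p k. apply ell_u_chain.
- intros x k hx. rewrite digamma_diff_dlnr by exact hx.
  unfold ell_tilde, u_tilde.
  generalize (ell_u_chain (2 * x + 1) k ltac:(lra)). lra.
- intros p k. apply error_chain.
- apply errors_vanish_dominated. intros k p hp.
  generalize (error_chain p k hp). lra.
- apply errors_vanish_dominated. intros k p hp.
  generalize (error_chain p k hp). lra.
- apply errors_vanish_dominated. intros k p hp.
  generalize (error_chain p k hp). lra.
- apply errors_vanish_dominated. intros k p hp.
  generalize (error_chain p k hp). lra.
Qed.
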